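(* Let $\mathfrak m$ be a multisegment such that $\mathfrak m$ is tame or $\mathfrak m^\vee$ is tame. Then: (1) if $\mathfrak m$ is distinguished, then $\mathfrak m$ is of Speh type; (2) if both $\mathfrak m$ and $\mathfrak m^\vee$ are distinguished, then $\mathfrak m$ is of Speh type. Moreover, every set of segments (i.e. every multisegment taking only the values $0$ and $1$) is tame, and every multisegment $\mathfrak m$ such that for every $x\in\mathbb Z$ at most two segments of $\mathfrak m$, counted with multiplicity, have endpoint $x$, is tame. Both inclusions are strict: there is a tame multisegment that is not a set, and there is a tame multisegment having, for some $x\in\mathbb Z$, more than two segments (counted with multiplicity) with endpoint $x$.
   Context: A segment is a set $[a,b]=\{a,a+1,\ldots,b\}$ of consecutive integers, $a\le b$; write $\mathbf b([a,b])=a$ (beginning), $\mathbf e([a,b])=b$ (endpoint), and $\mathrm{Sgm}$ for the set of segments. Put $\nu[a,b]=[a+1,b+1]$ and $[a,b]^\vee=[-b,-a]$. A multisegment is a finitely supported function $\mathfrak m:\mathrm{Sgm}\to\mathbb Z_{\ge0}$ (a finite multiset of segments); sums are pointwise; $(\nu^n\mathfrak m)(\Delta)=\mathfrak m(\nu^{-n}\Delta)$ and $\mathfrak m^\vee(\Delta)=\mathfrak m(\Delta^\vee)$. Define $S_{\mathfrak m}(\Delta)=\sum_{t\ge0}(-1)^t\mathfrak m(\nu^t\Delta)$ (a finite sum). Tameness: an integer $x$ is stable for $\mathfrak m$ if $S_{\mathfrak m}(\Gamma)\ge0$ for every segment $\Gamma$ with $\mathbf e(\Gamma)\ge x$. $\mathfrak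 m$ is tame if for every integer $x$ stable for $\mathfrak m$ and every segment $\Delta$ with $\mathbf e(\Delta)=x$, $S_{\mathfrak m}(\Delta)>0$ and $S_{\mathfrak m}(\nu\Delta)>0$, one has $\mathbf b(\Delta)\ge\mathbf b(\Gamma)$ for every segment $\Gamma$ with $\mathbf e(\Gamma)=x$ and $S_{\mathfrak m}(\Gamma)>0$. An order of $\mathfrak m$ is a listing $(\Delta_1,\ldots,\Delta_k)$ in which each segment $\Delta$ occurs exactly $\mathfrak m(\Delta)$ times. Write $[a,b]\prec[a',b']$ if $a<a'$, $b<b'$ and $b\ge a'-1$. An order is standard if $\Delta_i\not\prec\Delta_j$ whenever $i<j$. A decomposition of a segment $\Delta$ is a tuple of segments $(\Delta_1,\ldots,\Delta_r)$, $r\ge1$, with $\mathbf e(\Delta_1)=\mathbf e(\Delta)$, $\mathbf b(\Delta_r)=\mathbf b(\Delta)$ and $\mathbf e(\Delta_{i+1})=\mathbf b(\Delta_i)-1$ for $1\le i\le r-1$. A decomposition of an order $(\Delta_1,\ldots,\Delta_k)$ is a choice of a decomposition $(\Delta_{i,1},\ldots,\Delta_{i,k_i})$ of each $\Delta_i$; its index set is $I=\{(i,j):1\le i\le k,\ 1\le j\le k_i\}$, ordered lexicographically ($\prec_{\mathrm{lex}}$), and $(i,j)\ll(i',j')$ means $i<i'$. The decomposition is relevant to the order if there is an involution $\tau:I\to I$ with: (R1) $\tau(i,j+1)\ll\tau(i,j)$ for all $1\le i\le k$, $1\le j\le k_i-1$; (R2) $\tau(\imath)\ne\imath$ for all $\imath\in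 I$; (R3) $\Delta_\imath=\nu\Delta_{\tau(\imath)}$ whenever $\imath\prec_{\mathrm{lex}}\tau(\imath)$. $\mathfrak m$ is distinguished if every standard order of $\mathfrak m$ admits a relevant decomposition. $\mathfrak m$ is of Speh type if $\mathfrak m=\mathfrak n+\nu\mathfrak n$ for some multisegment $\mathfrak n$. *)

(* Defs.v *)
From HB Require Import structures.
From mathcomp Require Import all_boot all_order all_algebra.
From mathcomp Require Import finmap multiset classical_sets fsbigop.

Set Implicit Arguments.
Unset Strict Implicit.
Unset Printing Implicit Defensive.

Import Order.TTheory GRing.Theory Num.Theory.

Local Open Scope ring_scope.

(* The segment [a, b] = {a, a+1, ..., b}, a <= b, encoded by its end points. *)
Record segment := Segment {
  seg_pair : int * int;
  _ : seg_pair.1 <= seg_pair.2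
}.

HB.instance Definition _ := [isSub for seg_pair].
HB.instance Definition _ := [Countable of segment by <:].

Definition bgn (D : segment) : int := (val D).1.
Definition edp (D : segment) : int := (val D).2.

Lemma bgn_le_edp (D : segment) : bgn D <= edp D.
Proof. exact: (valP D). Qed.

Lemma segmentP (D E : segment) : bgn D = bgn E -> edp D = edp E -> D = E.
Proof.
rewrite /bgn /edp => eqb eqe; apply: val_inj.
by rewrite [LHS]surjective_pairing eqb eqe -surjective_pairing.
Qed.

Fact shift_subproof (n : int) (D : segment) : bgn D + n <= edp D + n.
Proof. by rewrite lerD2r bgn_le_edp. Qed.

(* nu^n D *)
Definition shift (n : int) (D : segment) : segment :=
  @Segment (bgn D + n, edp D + n) (shift_subproof n D).

Notation nu := (shift 1).

Fact dual_subproof (D : segment) : - edp D <= - bgn D.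
Proof. by rewrite lerN2 bgn_le_edp. Qed.

Definition dual (D : segment) : segment :=
  @Segment (- edp D, - bgn D) (dual_subproof D).

Lemma shiftK (n : int) : cancel (shift n) (shift (- n)).
Proof. by move=> D; apply: segmentP; rewrite /bgn /edp /= addrK. Qed.

Lemma shiftNK (n : int) : cancel (shift (- n)) (shift n).
Proof. by move=> D; apply: segmentP; rewrite /bgn /edp /= subrK. Qed.

Lemma dualK : involutive dual.
Proof. by move=> D; apply: segmentP; rewrite /bgn /edp /= opprK. Qed.

Notation multisegment := {mset segment}%mset.

(* nu^n m; the set of the comprehension only witnesses the finiteness of the
   support, see shiftmE. *)
Definition shiftm (n : int) (m : multisegment) : multisegment :=
  [fsfun D in [fset shift n E | E in finsupp m]%fset => m (shift (- n) D)].

Lemma shiftmE (n : int) (m : multisegment) (D : segment) :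
  shiftm n m D = m (shift (- n) D).
Proof.
rewrite fsfunE; case: ifPn => // /imfsetP notD.
case: finsuppP => // Dm; case: notD.
by exists (shift (- n) D) => //; rewrite shiftNK.
Qed.

Definition dualm (m : multisegment) : multisegment :=
  [fsfun D in [fset dual E | E in finsupp m]%fset => m (dual D)].

Lemma dualmE (m : multisegment) (D : segment) : dualm m D = m (dual D).
Proof.
rewrite fsfunE; case: ifPn => // /imfsetP notD.
case: finsuppP => // Dm; case: notD.
by exists (dual D) => //; rewrite dualK.
Qed.

(* Only finitely many terms are nonzero; see altsum_finite and altsumE. *)
Definition altsum (m : multisegment) (D : segment) : int :=
  \sum_(t \in [set: nat]%classic) (-1) ^+ t * (m (shift t%:Z D))%:Z.

Lemma altsum_finite (m : multisegment) (D : segment) :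
  exists N : nat, forall t : nat, (N <= t)%N -> m (shift t%:Z D) = 0%N.
Proof.
exists (\max_(E <- finsupp m) `|edp E - edp D|).+1 => t ltNt.
case: finsuppP => // /= Em; move: ltNt.
rewrite ltnNge (big_rem _ Em) /= leq_max {1}/edp /=.
by rewrite addrAC subrr add0r absz_nat leqnn.
Qed.

Lemma altsumE (m : multisegment) (D : segment) (N : nat) :
  (forall t : nat, (N <= t)%N -> m (shift t%:Z D) = 0%N) ->
  altsum m D = \sum_(t < N) (-1) ^+ t * (m (shift t%:Z D))%:Z.
Proof.
move=> m0; rewrite /altsum (fsbigTE [fset t in iota 0 N]%fset) => [|t].
  rewrite -(big_mkord xpredT (fun t => (-1) ^+ t * (m (shift t%:Z D))%:Z)).
  rewrite /index_iota subn0; apply: perm_big; apply: uniq_perm.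
  - exact: fset_uniq.
  - exact: iota_uniq.
  - by move=> t; rewrite inE.
by rewrite inE /= mem_iota add0n /= -leqNgt => /m0 ->; rewrite mulr0.
Qed.

Definition stable (m : multisegment) (x : int) : Prop :=
  forall G : segment, x <= edp G -> 0 <= altsum m G.

Definition tame (m : multisegment) : Prop :=
  forall (x : int) (D : segment),
    stable m x -> edp D = x -> 0 < altsum m D -> 0 < altsum m (nu D) ->
    forall G : segment, edp G = x -> 0 < altsum m G -> bgn G <= bgn D.

Definition prec (D E : segment) : bool :=
  [&& bgn D < bgn E, edp D < edp E & bgn E - 1 <= edp D].

Definition is_order (m : multisegment) (s : seq segment) : Prop :=
  forall D : segment, count_mem D s = m D.

Definition standard (s : seq segment) : bool :=
  pairwise (fun D E => ~~ prec D E) s.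

Definition seg_decomposition (D : segment) (s : seq segment) : bool :=
  if s is E :: s' then
    [&& edp E == edp D,
        path (fun X Y => edp Y == bgn X - 1) E s' &
        bgn (last E s') == bgn D]
  else false.

Definition decomposition (s : seq segment) (ss : seq (seq segment)) : bool :=
  all2 seg_decomposition s ss.

Section Relevant.

Variable ss : seq (seq segment).

(* The index set of ss; rows and columns are numbered from 0. *)
Definition index_set : finType :=
  {i : 'I_(size ss) & 'I_(size (tnth (in_tuple ss) i))}.

Definition irow (u : index_set) : nat := tag u.
Definition icol (u : index_set) : nat := tagged u.

Definition piece (u : index_set) : segment :=
  tnth (in_tuple (tnth (in_tuple ss) (tag u))) (tagged u).

Definition lex_lt (u v : index_set) : bool :=
  (irow u < irow v)%N || (irow u == irow v) && (icol u < icol v)%N.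

Definition row_lt (u v : index_set) : bool := (irow u < irow v)%N.

Definition relevant : Prop :=
  exists tau : index_set -> index_set,
    [/\ involutive tau,
        forall u v, irow u = irow v -> icol v = (icol u).+1 ->
          row_lt (tau v) (tau u),
        forall u, tau u <> u &
        forall u, lex_lt u (tau u) -> piece u = nu (piece (tau u))].

End Relevant.

Definition distinguished (m : multisegment) : Prop :=
  forall s : seq segment, is_order m s -> standard s ->
    exists2 ss : seq (seq segment), decomposition s ss & relevant ss.

Definition Speh_type (m : multisegment) : Prop :=
  exists n : multisegment, m = (n `+` shiftm 1 n)%mset.

Definition is_set (m : multisegment) : Prop :=
  forall D : segment, (m D <= 1)%N.

(* The number of segments of m with endpoint x, with multiplicity; m coerces
   to the sequence in which every segment D occurs m D times. *)
Definition endpoint_count (m : multisegment) (x : int) : nat :=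
  count (fun D => edp D == x) m.

(* Main.v *)
Require Import Defs.
From mathcomp Require Import all_boot all_order all_algebra finmap multiset.
From mathcomp Require Import zify.

(** Write S for [altsum m].  Since m D = S D + S (nu D), m is of Speh type as
    soon as S >= 0: take n = S o nu ([altsum_ge0_Speh]).  Where S >= 0, S (nu D)
    of the copies of D serve as lower partners of the copies of nu D, and the
    remaining S D copies wait for a partner nu^-1 D one endpoint further down.

    The point is to choose one standard order from which a relevant
    decomposition must exhibit these partners.  Sort by decreasing endpoint and
    consider the first segment D of the list.  Its pieces can only be upper
    members of their pairs.  In a relevant decomposition the partners of the
    successive pieces of a row lie in rows of decreasing number.  Hence the
    partner of a piece of D is the last piece of its row: a further piece would
    need a partner above the first row.  If D is the longest segment at its own
    endpoint, the partner of its leftmost piece must lie in a row with the next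
    lower endpoint; that row is then exactly nu^-1 D.  The partner of the
    rightmost piece of D lies in the same row or further down, at the same
    endpoint, and it is a whole row.  If the rows that follow nu^-1 D at its
    endpoint are never shorter, this row is not shorter than nu^-1 D, so D has a
    single piece, whose partner is the whole row nu^-1 D ([first_row_unsplit]).
    Both rows can then be deleted without disturbing the other pairs
    ([pairing_delete]), and the argument starts again with the rest of the list.

    So waiting segments should come longest first, and partners shortest first.
    The order [row_le] puts, at each endpoint, the segments that only wait
    before those that serve as partners, and uses the appropriate convention in
    each block.  A segment in the second block may also have waiting copies;
    tameness says that such a segment is the shortest waiting one at its
    endpoint, so the waiting copies still come longest first.  Descending
    through the endpoints, the deletions show that there are enough partners at
    each of them, that is, that every integer is stable ([tame_peel]).

    Reading an order backwards in the dual exchanges the two members of each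
    pair and preserves relevance ([decomposable_dual]), which reduces the case
    where [dualm m] is tame to the case where m is. *)

Set Implicit Arguments.
Unset Strict Implicit.
Unset Printing Implicit Defensive.

Import Order.TTheory GRing.Theory Num.Theory.

Local Open Scope ring_scope.

(** * Alternating sums *)

Lemma bgn_shift n D : bgn (shift n D) = bgn D + n. Proof. by []. Qed.
Lemma edp_shift n D : edp (shift n D) = edp D + n. Proof. by []. Qed.
Lemma bgn_dual D : bgn (dual D) = - edp D. Proof. by []. Qed.
Lemma edp_dual D : edp (dual D) = - bgn D. Proof. by []. Qed.

Lemma shift_shift n p D : shift n (shift p D) = shift (p + n) D.
Proof. by apply: segmentP; rewrite !(bgn_shift, edp_shift) addrA. Qed.

Lemma shift0 D : shift 0 D = D.
Proof. by apply: segmentP; rewrite !(bgn_shift, edp_shift) addr0. Qed.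

Lemma dual_shift n D : dual (shift n D) = shift (- n) (dual D).
Proof.
by apply: segmentP; rewrite !(bgn_shift, edp_shift, bgn_dual, edp_dual) opprD.
Qed.

Lemma mset_edp_bounded (m : multisegment) :
  exists B : int, forall D, B <= edp D -> m D = 0%N.
Proof.
suff [B Bs] : exists B : int, forall D, D \in (m : seq segment) -> edp D < B.
  exists B => D leBD; apply/eqP; rewrite -count_mem_mset -leqn0 leqNgt.
  rewrite -has_count has_pred1; apply/negP => /Bs.
  by rewrite ltNge leBD.
elim: (m : seq segment) => [|E s [B Bs]]; first by exists 0.
exists (Num.max B (edp E + 1)) => D; rewrite inE lt_max => /orP[/eqP->|/Bs->//].
by rewrite ltrDl ltr01 orbT.
Qed.

Lemma altsum0 (m : multisegment) D :
  (forall t : nat, m (shift t%:Z D) = 0%N) -> altsum m D = 0.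
Proof. by move=> m0; rewrite (@altsumE _ _ 0) ?big_ord0. Qed.

Lemma altsum_above (m : multisegment) D :
  (forall E, edp D <= edp E -> m E = 0%N) -> altsum m D = 0.
Proof.
by move=> m0; apply: altsum0 => t; apply: m0; rewrite edp_shift lerDl.
Qed.

Lemma altsum_rec (m : multisegment) D :
  altsum m D = (m D)%:Z - altsum m (nu D).
Proof.
have [N mN] := altsum_finite m D.
rewrite (@altsumE m D N.+1) => [|t /ltnW]; last exact: mN.
rewrite (@altsumE m (nu D) N) => [|t leNt]; last first.
  by rewrite shift_shift (mN t.+1)// leqW.
rewrite big_ord_recl expr0 mul1r shift0 -sumrN; congr (_ + _).
apply: eq_bigr => t _; by rewrite exprS mulN1r mulNr shift_shift.
Qed.

(** The recursion [altsum_rec] determines [altsum m] as soon as both sides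
    vanish far to the right, where it can be started. *)
Lemma altsum_unique (m : multisegment) (f : segment -> int) (B : int) :
  (forall D, f D = (m D)%:Z - f (nu D)) ->
  (forall D, B <= edp D -> f D = 0) -> altsum m =1 f.
Proof.
move=> fE f0; have [C mC] := mset_edp_bounded m.
have shiftE (n : nat) : forall D, Num.max B C <= edp D + n%:Z ->
    altsum m D = f D.
  elim: n => [|n IHn] D.
    rewrite addr0 ge_max => /andP[/f0 -> leCD].
    by rewrite altsum_above// => E /(le_trans leCD)/mC.
  move=> leD; rewrite altsum_rec fE IHn// edp_shift.
  by move: leD; lia.
move=> D; apply: (shiftE `|Num.max B C - edp D|%N).
by lia.
Qed.

(** The two contributions of a pair D + nu^-1 D telescope, except at D itself:
    removing the pair lowers by one the number of waiting copies of D and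
    changes nothing else. *)
Lemma altsum_pair (m n : multisegment) (D : segment) :
  (forall E : segment, m E = ((E == D) + (E == shift (-1) D) + n E)%N) ->
  forall E : segment, altsum m E = altsum n E + (E == D)%:Z.
Proof.
move=> mE; have [B nB] := mset_edp_bounded n.
apply: (@altsum_unique _ _ (Num.max B (edp D + 1))) => E; last first.
  rewrite ge_max => /andP[leBE ltDE].
  rewrite altsum_above => [|F /(le_trans leBE)/nB//].
  by case: eqP ltDE => // <-; lia.
rewrite altsum_rec mE (_ : E == shift (-1) D = (nu E == D)).
  by rewrite !PoszD; lia.
by apply/eqP/eqP => [->|<-]; rewrite ?shiftNK ?shiftK.
Qed.

(** Solving m = n + nu n from the right gives n = [altsum m] o nu. *)
Lemma altsum_ge0_Speh (m : multisegment) :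
  (forall D, 0 <= altsum m D) -> Speh_type m.
Proof.
move=> S_ge0.
pose n : multisegment := [fsfun E in finsupp m => `|altsum m (nu E)|%N].
have nE (D : segment) : n D = `|altsum m (nu D)|%N.
  rewrite fsfunE; case: ifPn => // mD; have := altsum_rec m D.
  by rewrite (fsfun_dflt mD); have := S_ge0 D; have := S_ge0 (nu D); lia.
exists n; apply/fsfunP => D; rewrite msetE2 shiftmE !nE shiftNK.
by have := altsum_rec m D; have := S_ge0 D; have := S_ge0 (nu D); lia.
Qed.

(** The dual of n + nu n is p + nu p, with p the dual of nu n. *)
Lemma Speh_dual (m : multisegment) : Speh_type (dualm m) -> Speh_type m.
Proof.
case=> n mE; exists (shiftm (-1) (dualm n)); apply/fsfunP => D.
have /(congr1 (fun p : multisegment => p (dual D))) := mE.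
rewrite dualmE dualK !msetE2 !shiftmE dualmE => ->.
by rewrite dualmE opprK !dual_shift shiftNK addnC.
Qed.

(** * Relevance through pairs of natural numbers *)

Definition seg0 : segment := @Segment (0, 0) (lexx 0).

(** The involutions of the definition of relevance, with an index (i, j)
    replaced by a pair of plain natural numbers: rows can then be deleted or
    reversed without transporting dependent types.  Rows past the end of [ss]
    read as empty, so the bound on the row number is implied. *)
Definition cell (ss : seq (seq segment)) (u : nat * nat) : bool :=
  (u.2 < size (nth [::] ss u.1))%N.

Definition piece_at (ss : seq (seq segment)) (u : nat * nat) : segment :=
  nth seg0 (nth [::] ss u.1) u.2.

Definition cell_lt (u v : nat * nat) : bool :=
  (u.1 < v.1)%N || (u.1 == v.1) && (u.2 < v.2)%N.

Definition pairing (ss : seq (seq segment)) (t : nat * nat -> nat * nat) :=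
  [/\ forall u, cell ss u -> cell ss (t u),
      forall u, cell ss u -> t (t u) = u,
      forall i j, cell ss (i, j.+1) -> ((t (i, j.+1)).1 < (t (i, j)).1)%N,
      forall u, cell ss u -> t u <> u &
      forall u, cell ss u -> cell_lt u (t u) ->
        piece_at ss u = nu (piece_at ss (t u))].

Definition decomposable (s : seq segment) : Prop :=
  exists2 ss, decomposition s ss & exists t, pairing ss t.

Lemma relevant_pairing (ss : seq (seq segment)) :
  relevant ss -> exists t, pairing ss t.
Proof.
case=> tau [tauK tauR1 tauR2 tauR3].
pose enc (v : index_set ss) := (irow v, icol v).
have enc_inj : injective enc.
  case=> [i j] [i' j'] []; rewrite /irow /icol /= => /val_inj eqi.
  by case: _ / eqi j' => j' /val_inj ->.
have cell_enc v : cell ss (enc v).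
  case: v => i j; rewrite /cell /= /irow /icol /=.
  rewrite -(tnth_nth [::] (in_tuple ss)).
  exact: ltn_ord.
have encP u : cell ss u -> exists v, enc v = u.
  case: u => i j; rewrite /cell /= => ltj.
  have lti : (i < size ss)%N.
    by rewrite ltnNge; apply: contraL ltj => /(nth_default _) ->.
  have ltj' : (j < size (tnth (in_tuple ss) (Ordinal lti)))%N.
    by rewrite (tnth_nth [::]).
  by exists (Tagged (fun i => 'I_(size (tnth (in_tuple ss) i))) (Ordinal ltj')).
have pieceE v : piece_at ss (enc v) = piece v.
  rewrite /piece (tnth_nth seg0) /piece_at; congr (nth _ _ _).
  by rewrite (tnth_nth [::]).
pose t u := if [pick v | enc v == u] is Some v then enc (tau v) else u.
have tE v : t (enc v) = enc (tau v).
  rewrite /t; case: pickP => [w /eqP/enc_inj->//|/(_ v)].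
  by rewrite eqxx.
exists t; split.
- by move=> _ /encP[v <-]; rewrite tE.
- by move=> _ /encP[v <-]; rewrite !tE tauK.
- move=> i j cS.
  have cj : cell ss (i, j) by apply: leq_trans cS; rewrite /= ltnW.
  have [[v vE] [w wE]] := (encP _ cj, encP _ cS).
  rewrite -vE -wE !tE; case: vE wE => vi vj [wi wj].
  by apply: tauR1; [rewrite vi wi | rewrite vj wj].
- by move=> _ /encP[v <-]; rewrite tE => /enc_inj/tauR2.
- by move=> _ /encP[v <-]; rewrite tE !pieceE => /tauR3.
Qed.

Lemma decompositionP (s : seq segment) (ss : seq (seq segment)) :
  reflect (size s = size ss /\ forall i, (i < size s)%N ->
             seg_decomposition (nth seg0 s i) (nth [::] ss i))
          (decomposition s ss).
Proof.
rewrite /decomposition; apply: (iffP idP).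
  elim: s ss => [|D s IHs] [|r ss]//= /andP[Dr /IHs[-> dec]].
  by split=> // -[|i] //= /dec.
elim: s ss => [|D s IHs] [|r ss] [] //= [szs] dec.
by rewrite (dec 0%N)//= IHs//; split=> // i /(dec i.+1).
Qed.

Lemma seg_decompositionE (D : segment) (r : seq segment) :
  seg_decomposition D r =
  [&& r != [::], edp (head seg0 r) == edp D,
      sorted (fun X Y => edp Y == bgn X - 1) r & bgn (last seg0 r) == bgn D].
Proof. by case: r. Qed.

(** Pieces are listed from right to left and do not overlap. *)
Lemma seg_decomposition_nth (D : segment) (r : seq segment) :
  seg_decomposition D r ->
  [/\ (0 < size r)%N, edp (nth seg0 r 0) = edp D,
      bgn (nth seg0 r (size r).-1) = bgn D &
      forall i j, (i < j < size r)%N ->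
        edp (nth seg0 r j) < bgn (nth seg0 r i)].
Proof.
rewrite seg_decompositionE => /and4P[r_n0 /eqP edpr sr /eqP bgnr].
split=> [||| i j /andP[ltij ltj]].
- by rewrite lt0n size_eq0.
- by rewrite nth0.
- by rewrite nth_last.
have tr : transitive (fun X Y => edp Y < bgn X).
  by move=> Y X Z ltYX ltZY; have := bgn_le_edp Y; lia.
have sr' : sorted (fun X Y => edp Y < bgn X) r.
  by apply: sub_sorted sr => X Y /eqP ->; lia.
apply: (sorted_ltn_nth tr seg0 sr') (ltij); rewrite inE //.
exact: ltn_trans ltj.
Qed.

Lemma seg_decomposition_dual (D : segment) (r : seq segment) :
  seg_decomposition D r -> seg_decomposition (dual D) (rev (map dual r)).
Proof.
case: (lastP r) => // r' E; rewrite !seg_decompositionE.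
rewrite map_rcons rev_rcons -rev_rcons -map_rcons.
case/and4P=> _ edpr sr bgnr; rewrite rev_sorted sorted_map; apply/and4P; split.
- by rewrite -size_eq0 size_rev size_map size_rcons.
- by rewrite map_rcons rev_rcons /= !edp_dual -(eqP bgnr) last_rcons.
- apply: sub_sorted sr => X Y /eqP /=; rewrite edp_dual bgn_dual => ->.
  by apply/eqP; lia.
- rewrite bgn_dual -(eqP edpr).
  by case: (rcons r' E) => [|F r''] //=; rewrite rev_cons last_rcons.
Qed.

Lemma nth_delete (T : Type) (x0 : T) (s : seq T) (p i : nat) :
  (p < size s)%N -> nth x0 (take p s ++ drop p.+1 s) i = nth x0 s (bump p i).
Proof.
move=> ltp; rewrite nth_cat size_takel ?(ltnW ltp)// /bump.
case: ltnP => [lti|lepi]; first by rewrite nth_take.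
by rewrite nth_drop addSn subnKC.
Qed.

(** When the first row and a later row p + 1 are single pieces paired with each
    other, no pair straddles the deletion of these two rows. *)
Lemma pairing_delete (r : seq segment) (ss : seq (seq segment)) t (p : nat) :
    pairing (r :: ss) t -> size r = 1%N -> size (nth [::] ss p) = 1%N ->
    t (0, 0)%N = (p.+1, 0)%N ->
  exists t', pairing (take p ss ++ drop p.+1 ss) t'.
Proof.
move=> [tcell tK tR1 tR2 tR3] szr szp t00.
have ltp : (p < size ss)%N.
  rewrite ltnNge; apply/negP => /(nth_default [::]) szp0.
  by rewrite szp0 in szp.
pose f (u : nat * nat) := ((bump p u.1).+1, u.2).
pose g (u : nat * nat) := (unbump p u.1.-1, u.2).
have fK : cancel f g by case=> i j; rewrite /f /g /= bumpK.
have cellE u : cell (take p ss ++ drop p.+1 ss) u = cell (r :: ss) (f u).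
  by rewrite /cell nth_delete.
have pieceE u :
    piece_at (take p ss ++ drop p.+1 ss) u = piece_at (r :: ss) (f u).
  by rewrite /piece_at nth_delete.
(* a cell outside the two deleted rows has its partner outside them too *)
have gK u : cell (r :: ss) (f u) -> f (g (t (f u))) = t (f u).
  move=> cu; have := tcell _ cu; have := tK _ cu; have := tK (0, 0)%N.
  rewrite t00 /cell /= szr => /(_ isT) tp.
  case: (t (f u)) => [[|i] j] /=.
    rewrite szr; case: j => //; rewrite t00 => -[/eqP].
    by rewrite (negPf (neq_bump _ _)).
  have [-> | neip _ _] := eqVneq i p; last by rewrite /f /g /= unbumpK.
  by rewrite szp; case: j => //; rewrite tp.
have rltE u v : ((f u).1 < (f v).1)%N = (u.1 < v.1)%N.
  by rewrite /= ltnS ltnNge leq_bump2 -ltnNge.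
have fltE u v : cell_lt (f u) (f v) = cell_lt u v.
  by rewrite /cell_lt rltE /= eqSS (inj_eq (can_inj (bumpK p))).
exists (fun u => g (t (f u))); split.
- by move=> u; rewrite !cellE => cu; rewrite gK// tcell.
- by move=> u; rewrite !cellE => cu; rewrite gK// tK// fK.
- move=> i j; rewrite cellE => cS.
  have cj : cell (r :: ss) (f (i, j)) by apply: leq_trans cS; rewrite /= ltnW.
  by rewrite -rltE !gK//; apply: tR1.
- move=> u; rewrite cellE => cu /(congr1 f); rewrite gK//; exact: tR2.
- move=> u; rewrite cellE => cu; rewrite -fltE gK// => /(tR3 _ cu).
  by rewrite !pieceE gK.
Qed.

(** The dual of an order is read backwards, and so are the pieces of each of
    its members.  Reversing both rows and columns preserves the condition on the
    rows of consecutive partners; it also exchanges the two members of a pair,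
    as it must since duality turns nu into its inverse. *)
Lemma decomposable_dual (s : seq segment) :
  decomposable s -> decomposable (rev (map dual s)).
Proof.
case=> ss /decompositionP[szs dec] [t [tcell tK tR1 tR2 tR3]].
pose ss' := rev (map (fun r => rev (map dual r)) ss).
have szss' : size ss' = size ss by rewrite size_rev size_map.
have nth_ss' i : (i < size ss)%N ->
    nth [::] ss' i = rev (map dual (nth [::] ss (size ss - i.+1))).
  move=> lti; rewrite nth_rev size_map// (nth_map [::])//.
  by rewrite ltn_subrL /= (leq_ltn_trans _ lti).
have sz_row i : (i < size ss)%N ->
    size (nth [::] ss' i) = size (nth [::] ss (size ss - i.+1)).
  by move=> lti; rewrite nth_ss'// size_rev size_map.
have revK i : (i < size ss)%N -> (size ss - (size ss - i.+1).+1)%N = i by lia.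
have rev_lt i : (i < size ss)%N -> (size ss - i.+1 < size ss)%N by lia.
have cell_row r u : cell r u -> (u.1 < size r)%N.
  move=> cu; rewrite ltnNge; apply: contraL cu => /(nth_default [::]).
  by rewrite /cell => ->.
pose flip (r : seq (seq segment)) (u : nat * nat) :=
  ((size r - u.1.+1)%N, (size (nth [::] r u.1) - u.2.+1)%N).
have cell_flip u : cell ss u -> cell ss' (flip ss u).
  move=> cu; have ltu := cell_row _ _ cu; move: cu.
  by rewrite /cell /= sz_row ?rev_lt// revK//; lia.
have cell_flip' u : cell ss' u -> cell ss (flip ss' u).
  move=> cu; have := cell_row _ _ cu; rewrite szss' => ltu; move: cu.
  by rewrite /cell /= szss' sz_row//; lia.
have flipK u : cell ss u -> flip ss' (flip ss u) = u.
  case: u => i j cu; have /= ltu := cell_row _ _ cu; move: cu.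
  rewrite /flip /cell /= szss' sz_row ?rev_lt// revK// => ltj.
  by congr pair; lia.
have flipK' u : cell ss' u -> flip ss (flip ss' u) = u.
  case: u => i j cu; have := cell_row _ _ cu; rewrite szss' /= => ltu; move: cu.
  rewrite /flip /cell /= szss' sz_row// revK// => ltj.
  by congr pair; lia.
have pieceE u : cell ss' u -> piece_at ss' u = dual (piece_at ss (flip ss' u)).
  move=> cu; have := cell_row _ _ cu; rewrite szss' => ltu; move: cu.
  rewrite /cell /piece_at /= szss' sz_row// nth_ss'// => ltj.
  by rewrite nth_rev ?size_map// (nth_map seg0)//; lia.
have flip_lt u v : cell ss' u -> cell ss' v ->
    cell_lt (flip ss' u) (flip ss' v) = cell_lt v u.
  case: u v => [i j] [i' j'] cu cv; have := cell_row _ _ cu.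
  have := cell_row _ _ cv; move: cu cv; rewrite /cell_lt /cell /= szss'.
  move=> ltj ltj' lti' lti; rewrite ltn_sub2lE//; congr orb.
  have [eqi | nei] := eqVneq i' i; last first.
    by apply/andP => -[/eqP]; move: nei; lia.
  by move: ltj'; rewrite eqi eqxx /= => ltj'; rewrite ltn_sub2lE.
exists ss'.
  apply/decompositionP; rewrite size_rev size_map szss'; split=> // i lti.
  have ltis : (i < size ss)%N by rewrite -szs.
  rewrite nth_rev size_map// (nth_map seg0) ?szs ?rev_lt//.
  by rewrite nth_ss'//; apply: seg_decomposition_dual; apply: dec; lia.
exists (fun u => flip ss (t (flip ss' u))); split.
- by move=> u /cell_flip'/tcell/cell_flip.
- move=> u cu; have cfu := cell_flip' _ cu.
  by rewrite flipK ?tcell// tK// flipK'.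
- move=> i j cS.
  have cj : cell ss' (i, j) by apply: leq_trans cS; rewrite /= ltnW.
  have rowt u : cell ss' u -> ((t (flip ss' u)).1 < size ss)%N.
    by move=> /cell_flip'/tcell/cell_row.
  rewrite /= ltn_sub2lE ?rowt// ltnS.
  have flipE : flip ss' (i, j) =
      ((flip ss' (i, j.+1)).1, (flip ss' (i, j.+1)).2.+1).
    by move: cS; rewrite /flip /cell /= => cS; congr pair; lia.
  by rewrite flipE; apply: tR1; rewrite -flipE; apply: cell_flip'.
- move=> u cu tu; apply: (tR2 (flip ss' u)); first exact: cell_flip'.
  by rewrite -[in RHS]tu flipK ?tcell ?cell_flip'.
- move=> u cu; have cfu := cell_flip' _ cu.
  have cv : cell ss' (flip ss (t (flip ss' u))) by apply/cell_flip/tcell.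
  rewrite -flip_lt// flipK ?tcell// !pieceE// flipK ?tcell// => lt_tu.
  rewrite (tR3 _ (tcell _ cfu)) tK// dual_shift shiftNK //.
Qed.

(** * Splitting off the first row *)

(** Along a row, the rows of the partners strictly decrease; two members of one
    row exchanged by the involution would break this. *)
Lemma pairing_row_neq (ss : seq (seq segment)) t (u : nat * nat) :
  pairing ss t -> cell ss u -> (t u).1 <> u.1.
Proof.
case=> tcell tK tR1 tR2 _.
have R1 i j j' : (j < j')%N -> cell ss (i, j') ->
    ((t (i, j')).1 < (t (i, j)).1)%N.
  elim: j' => // j' IHj'; rewrite ltnS leq_eqVlt => /orP[/eqP->|ltj] cj'.
    exact: tR1.
  by apply: ltn_trans (tR1 _ _ cj') _; apply: IHj' => //; apply: ltnW.
case: u => i j cij /= ti; have := tR2 _ cij; have := tK _ cij.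
have := tcell _ cij; case tij: (t (i, j)) ti => [i' j'] /= eqi.
rewrite {i'}eqi in tij *.
move=> cij' tij' ne.
have [ltj|ltj|eqj] := ltngtP j j'.
- by have := R1 _ _ _ ltj cij'; rewrite tij tij' /= ltnn.
- by have := R1 _ _ _ ltj cij; rewrite tij tij' /= ltnn.
- by apply: ne; rewrite eqj.
Qed.

(** Let q and p be the rows of the partners of the leftmost and of the rightmost
    piece of D; q does not exceed p by the condition on consecutive partners.
    Both partners end their rows.  Hence row q begins at [bgn D - 1], which
    excludes the endpoint of D as its own endpoint, and row p, squeezed between
    two bounds on endpoints, ends where the partner of the rightmost piece ends:
    this partner is all of row p.  If D had several pieces, row p would be a
    segment shorter than nu^-1 D coming after row q = nu^-1 D, which the third
    hypothesis forbids. *)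
Lemma first_row_unsplit (le : rel segment) (D : segment) (s : seq segment) :
    (forall E F, le E F -> edp F <= edp E) ->
    (forall E, E \in s -> edp E = edp D -> bgn D <= bgn E) ->
    (forall E, le (shift (-1) D) E -> edp E = edp D - 1 ->
      bgn E <= bgn D - 1) ->
    pairwise le (D :: s) -> decomposable (D :: s) ->
  exists2 p, (p < size s)%N /\ nth seg0 s p = shift (-1) D &
    decomposable (take p s ++ drop p.+1 s).
Proof.
move=> le_edp firstD le_partner le_s [[|r ss] // /decompositionP[[szs] dec]].
case=> t prg; have [tcell tK tR1 tR2 tR3] := prg.
have decr : seg_decomposition D r by apply: (dec 0%N).
have [r_gt0 edp_r bgn_r r_lt] := seg_decomposition_nth decr.
have le_nth i j : (i < j < size (D :: s))%N ->
    le (nth seg0 (D :: s) i) (nth seg0 (D :: s) j).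
  case/andP=> ltij ltj; apply: (pairwiseP seg0 le_s) => //.
  exact: ltn_trans ltj.
(* no row precedes that of D, so each piece of D is the upper one of its pair *)
have t_r j : (j < size r)%N -> exists2 p, (p < size s)%N & exists k,
    [/\ t (0, j)%N = (p.+1, k), t (p.+1, k) = (0, j)%N,
        (k < size (nth [::] ss p))%N &
        nth seg0 r j = nu (nth seg0 (nth [::] ss p) k)].
  move=> ltj; have c0j : cell (r :: ss) (0, j)%N by [].
  have := pairing_row_neq prg c0j; have := tR3 _ c0j; have := tcell _ c0j.
  have := tK _ c0j; case: (t (0, j)%N) => -[|p] k //= tpk cpk pieceE _.
  exists p; last by exists k; split=> //; apply: pieceE.
  rewrite szs ltnNge; apply: contraL cpk => /(nth_default [::]).
  by rewrite /cell /= => ->.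
have [q ltq [l [t0q tql ltl pieceq]]] : exists2 q, (q < size s)%N & exists l,
    [/\ t (0, (size r).-1)%N = (q.+1, l), t (q.+1, l) = (0, (size r).-1)%N,
        (l < size (nth [::] ss q))%N &
        nth seg0 r (size r).-1 = nu (nth seg0 (nth [::] ss q) l)].
  by apply: t_r; rewrite prednK.
have [p ltp [k [t0p tpk ltk piecep]]] := t_r _ r_gt0.
have decq := dec q.+1 ltq; have decp := dec p.+1 ltp.
have [_ edp_q bgn_q q_lt] := seg_decomposition_nth decq.
have [_ edp_p bgn_p p_lt] := seg_decomposition_nth decp.
rewrite /= in edp_q bgn_q q_lt edp_p bgn_p p_lt.
have le_qp : (q <= p)%N.
  have [j szr] : exists j, size r = j.+1 by exists (size r).-1; rewrite prednK.
  move: t0q; rewrite szr /= => t0q.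
  case: j szr t0q => [|j] szr t0q; first by move: t0q; rewrite t0p => -[->].
  have desc i : (i <= j)%N -> ((t (0, i.+1)).1 < (t (0, 0)%N).1)%N.
    elim: i => [|i IHi] leij; first by apply: tR1; rewrite /cell /= szr.
    apply: ltn_trans (IHi _); last exact: ltnW.
    by apply: tR1; rewrite /cell /= szr.
  by have := desc j (leqnn j); rewrite t0q t0p ltnS => /ltnW.
(* the next piece of the row would need a partner above the first row *)
have last_piece i h j : t (i, h) = (0, j)%N ->
    (h < size (nth [::] (r :: ss) i))%N -> h = (size (nth [::] (r :: ss) i)).-1.
  move=> tih lth; suff: ~~ (h.+1 < size (nth [::] (r :: ss) i))%N.
    by move: lth; set n := size _; lia.
  by apply/negP => ltS; have := tR1 i h ltS; rewrite tih ltn0.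
have lE := last_piece _ _ _ tql ltl; have kE := last_piece _ _ _ tpk ltk.
rewrite /= in lE kE.
have bgn_sq : bgn (nth seg0 s q) = bgn D - 1.
  by rewrite -bgn_q -lE -bgn_r pieceq bgn_shift addrK.
have sq : nth seg0 s q \in s by exact: mem_nth.
have ltqD : edp (nth seg0 s q) < edp D.
  have := le_edp _ _ (le_nth 0%N q.+1 ltq).
  rewrite le_eqVlt => /orP[/eqP/=eqD|//].
  by have := firstD _ sq eqD; rewrite bgn_sq; lia.
have le_sqp : edp (nth seg0 s p) <= edp (nth seg0 s q).
  move: le_qp; rewrite leq_eqVlt => /orP[/eqP->//|ltqp].
  by apply: le_edp; apply: (le_nth q.+1 p.+1); rewrite !ltnS ltqp.
have edp_k : edp (nth seg0 (nth [::] ss p) k) = edp D - 1.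
  by rewrite -edp_r piecep edp_shift addrK.
have k0 : k = 0%N.
  case: k ltk edp_k {t0p tpk piecep kE} => // k ltk edp_k.
  have := p_lt 0%N k.+1; rewrite ltk => /(_ isT); rewrite edp_k.
  by have := bgn_le_edp (nth seg0 (nth [::] ss p) 0); rewrite edp_p; lia.
have {}edp_p : edp (nth seg0 s p) = edp D - 1 by rewrite -edp_p -edp_k k0.
have sqE : nth seg0 s q = shift (-1) D.
  by apply: segmentP; rewrite ?bgn_shift ?edp_shift//; lia.
have szp : size (nth [::] ss p) = 1%N.
  by rewrite -(prednK (leq_ltn_trans _ ltk))// -kE k0.
have bgn_sp : bgn (nth seg0 s p) = bgn (nth seg0 r 0) - 1.
  by rewrite -bgn_p szp piecep k0 bgn_shift addrK.
have le_bgn : bgn (nth seg0 r 0) <= bgn D.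
  move: le_qp; rewrite leq_eqVlt => /orP[/eqP eqpq|ltqp].
    by move: bgn_sp; rewrite -eqpq bgn_sq; lia.
  have lepq : le (shift (-1) D) (nth seg0 s p).
    by rewrite -sqE; apply: (le_nth q.+1 p.+1); rewrite !ltnS ltqp.
  by have := le_partner _ lepq edp_p; lia.
have szr : size r = 1%N.
  apply/eqP; rewrite eqn_leq r_gt0 andbT leqNgt; apply/negP => gt1.
  have := r_lt 0%N (size r).-1.
  rewrite prednK// leqnn andbT -subn1 subn_gt0 gt1.
  move/(_ isT); have := bgn_le_edp (nth seg0 r (size r).-1).
  by rewrite bgn_r -subn1; lia.
move: t0q; rewrite szr /= t0p => -[eqpq _]; rewrite -eqpq in sqE.
exists p => //; exists (take p ss ++ drop p.+1 ss); last first.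
  by apply: pairing_delete prg szr szp _; rewrite t0p k0.
apply/decompositionP; split=> [|i lti].
  by rewrite !size_cat !size_take !size_drop szs.
rewrite !nth_delete ?szs -?szs//; apply: (dec (bump p i).+1).
move: lti; rewrite size_cat size_takel ?(ltnW ltp)// size_drop /= ltnS /bump.
by case: leqP; lia.
Qed.

(** * The order attached to a tame multisegment *)

(** Rows are sorted by decreasing endpoint.  At a given endpoint come first
    the D with [altsum m (nu D) <= 0], whose copies all wait for a partner
    nu^-1 D further down the list, the longest one first; then the D that serve
    as partners of nu D, the shortest one first.  The two opposite conventions
    are the ones that [first_row_unsplit] asks for; tameness makes them agree on
    a segment that both serves and waits. *)
Definition row_key (m : multisegment) (D : segment) :
    int *l (bool *l int) :=
  let partner := 0 < altsum m (nu D) in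
  (- edp D, (partner, if partner then - bgn D else bgn D)).

Definition row_le (m : multisegment) : rel segment :=
  fun D E => (row_key m D <= row_key m E)%O.

Lemma row_leE (m : multisegment) (D E : segment) :
  row_le m D E =
    (edp E < edp D) || (edp E == edp D) &&
      if 0 < altsum m (nu D)
      then (0 < altsum m (nu E)) && (bgn E <= bgn D)
      else (0 < altsum m (nu E)) || (bgn D <= bgn E).
Proof.
rewrite /row_le /row_key !leEprodlexi /= !lerN2 leEbool.
case: (ltgtP (edp E) (edp D)) => //= _.
by case: (0 < altsum m (nu D)); case: (0 < altsum m (nu E)); rewrite /= ?lerN2.
Qed.

Lemma row_le_total m : total (row_le m).
Proof. by move=> D E; apply: le_total. Qed.

Lemma row_le_trans m : transitive (row_le m).
Proof. by move=> E D F; apply: le_trans. Qed.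

Lemma row_le_edp m D E : row_le m D E -> edp E <= edp D.
Proof. by rewrite row_leE => /orP[/ltW//|/andP[/eqP->]]. Qed.

Lemma standard_row_sort m (s : seq segment) : standard (sort (row_le m) s).
Proof.
have : pairwise (row_le m) (sort (row_le m) s).
  rewrite -(sorted_pairwise (@row_le_trans m)).
  exact: sort_sorted (@row_le_total m) s.
apply: sub_pairwise => D E /row_le_edp leED.
by rewrite /prec (ltNge (edp D)) leED andbF.
Qed.

(** The list [s] is what is left of [m] after the removal of pairs whose upper
    members have endpoint at least [x]: above [x] nothing remains, at [x] only
    waiting copies do, and the alternating sums are untouched below [x].  When
    the list starts at a lower endpoint, all segments in between have been used
    up, so the alternating sums vanish there and [x] can be lowered to that
    endpoint. *)
Lemma tame_peel (m : multisegment) (s : seq segment) (x : int) :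
    tame m -> stable m x -> pairwise (row_le m) s -> decomposable s ->
    (forall D, D \in s -> edp D <= x) ->
    (forall D, edp D = x -> (count_mem D s)%:Z <= altsum m D) ->
    (forall D, edp D < x -> altsum (seq_mset s) D = altsum m D) ->
  forall D, 0 <= altsum m D.
Proof.
move=> tame_m; have [n] := ubnP (size s); elim: n s x => // n IHn [|D s] x.
  move=> _ m_x _ _ _ _ Ss E; have [/m_x//|/Ss <-] := leP x (edp E).
  by rewrite altsum0// => t; rewrite mset_seqE.
rewrite /= ltnS => ltsn m_x /[dup] le_Ds /andP[le_D le_s] dec_Ds Ds_le cnt_x Ss.
have leDx : edp D <= x by rewrite Ds_le ?mem_head.
have s_le E : E \in D :: s -> edp E <= edp D.
  rewrite inE => /orP[/eqP->//|sE]; apply: row_le_edp (allP le_D _ sE).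
have Ss_above E : edp D < edp E -> altsum (seq_mset (D :: s)) E = 0.
  move=> ltDE; rewrite altsum_above// => F leEF; rewrite mset_seqE.
  apply/count_memPn; apply: contraL leEF => /s_le leFD; rewrite -ltNge.
  exact: le_lt_trans ltDE.
have Ss_at E : edp E = edp D ->
    altsum (seq_mset (D :: s)) E = (count_mem E (D :: s))%:Z.
  move=> eqE; rewrite altsum_rec Ss_above ?subr0 ?mset_seqE//.
  by rewrite edp_shift eqE; lia.
have m_D : stable m (edp D).
  move=> E leDE; have [/m_x//|ltEx] := leP x (edp E); rewrite -Ss//.
  move: leDE; rewrite le_eqVlt => /orP[/eqP eqD|/Ss_above->//].
  by rewrite Ss_at.
have {}cnt_x E : edp E = edp D -> (count_mem E (D :: s))%:Z <= altsum m E.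
  move=> eqE; have [eqx|nex] := eqVneq (edp D) x.
    by apply: cnt_x; rewrite eqE.
  by rewrite -Ss_at// Ss// eqE lt_neqAle nex.
have pos_D E : E \in D :: s -> edp E = edp D -> 0 < altsum m E.
  move=> sE /cnt_x; apply: lt_le_trans; rewrite ltz_nat -has_count has_pred1//.
have S_D := pos_D D (mem_head _ _) erefl.
have [|E|E|p [ltp sp] dec_s'] :=
  @first_row_unsplit (row_le m) D s _ _ _ le_Ds dec_Ds.
- exact: (@row_le_edp m).
- move=> sE eqE; have := allP le_D _ sE; rewrite row_leE eqE ltxx eqxx /=.
  have S_E : 0 < altsum m E by apply: pos_D => //; rewrite inE sE orbT.
  (* E serves and waits, whether or not D serves: tameness applies to E *)
  by case: ifP => _ => [/andP[EE _]|/orP[EE|//]]; apply: (tame_m (edp D) E).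
- rewrite row_leE /= shiftNK S_D bgn_shift edp_shift => + eqE.
  by rewrite eqE ltxx eqxx /= => /andP[].
set s' := take p s ++ drop p.+1 s in dec_s'.
have sE E : count_mem E s = ((E == shift (-1) D) + count_mem E s')%N.
  rewrite -[in LHS](cat_take_drop p s) (drop_nth seg0 ltp) sp /s'.
  rewrite !count_cat /=.
  by rewrite eq_sym addnCA.
apply: (IHn s' (edp D)) => //.
- apply: leq_trans ltsn.
  by rewrite size_cat size_takel ?size_drop ?(ltnW ltp)//; lia.
- apply: subseq_pairwise le_s; rewrite -[X in subseq _ X](cat_take_drop p s).
  by rewrite cat_subseq// -add1n -drop_drop drop_subseq.
- move=> E s'E; apply: s_le; rewrite inE -[E \in s]has_pred1 has_count sE.
  by rewrite addn_gt0 -has_count has_pred1 s'E !orbT.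
- move=> E /cnt_x; apply: le_trans; rewrite /= sE lez_nat.
  by rewrite addnA leq_addl.
- move=> E ltED; rewrite -Ss; last exact: lt_le_trans leDx.
  rewrite (@altsum_pair (seq_mset (D :: s)) (seq_mset s') D) => [|F].
    by case: eqP ltED => [->|_]; rewrite ?ltxx ?addr0.
  by rewrite !mset_seqE /= sE eq_sym addnA.
Qed.

Lemma tame_decomposable_Speh (m : multisegment) :
  tame m -> decomposable (sort (row_le m) m) -> Speh_type m.
Proof.
move=> tame_m dec_m; apply: altsum_ge0_Speh.
have [B mB] := mset_edp_bounded m.
have m0 D : B <= edp D -> altsum m D = 0.
  by move=> leBD; rewrite altsum_above// => E /(le_trans leBD)/mB.
have cntE D : count_mem D (sort (row_le m) m) = m D.
  by rewrite count_sort count_mem_mset.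
apply: (@tame_peel m _ B) dec_m _ _ _ => //.
- by move=> D /m0 ->.
- rewrite -(sorted_pairwise (@row_le_trans m)).
  exact: sort_sorted (@row_le_total m) m.
- move=> D; rewrite -has_pred1 has_count cntE.
  by apply: contraLR; rewrite -ltNge => /ltW/mB ->.
- by move=> D eqB; rewrite cntE mB ?eqB// m0 ?eqB.
- move=> D _; congr altsum; apply/msetP => E.
  by rewrite mset_seqE cntE.
Qed.

Lemma distinguished_sort (m : multisegment) :
  distinguished m -> decomposable (sort (row_le m) m).
Proof.
move=> dist_m.
have [|ss dec rel] := dist_m (sort (row_le m) m) _ (standard_row_sort m m).
  by move=> D; rewrite count_sort count_mem_mset.
by exists ss => //; apply: relevant_pairing.
Qed.

(** The row-sorted order of [dualm m], read backwards and dualized, is a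
    standard order of m. *)
Lemma distinguished_sort_dual (m : multisegment) :
  distinguished m -> decomposable (sort (row_le (dualm m)) (dualm m)).
Proof.
move=> dist_m; set s := sort _ _.
have [||ss dec rel] := dist_m (rev (map dual s)).
- move=> D; rewrite count_rev count_map (eq_count (a2 := pred1 (dual D))).
    by rewrite count_sort count_mem_mset dualmE dualK.
  by move=> E /=; rewrite -(inj_eq (inv_inj dualK)) dualK.
- pose le D E := row_le (dualm m) (dual E) (dual D).
  have le_trans : transitive le by move=> E D F /[swap]; apply: row_le_trans.
  have : pairwise le (rev (map dual s)).
    rewrite -sorted_pairwise// rev_sorted sorted_map.
    have := sort_sorted (@row_le_total (dualm m)) (dualm m).
    by apply: sub_sorted => D E /=; rewrite /le !dualK.
  apply: sub_pairwise => D E /row_le_edp; rewrite !edp_dual lerN2 => leED.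
  by rewrite /prec ltNge leED.
have /decomposable_dual : decomposable (rev (map dual s)).
  by exists ss => //; apply: relevant_pairing.
by rewrite map_rev revK -map_comp map_id_in// => D _ /=; rewrite dualK.
Qed.

Lemma tame_distinguished_Speh (m : multisegment) :
  tame m \/ tame (dualm m) -> distinguished m -> Speh_type m.
Proof.
move=> [tame_m | tame_m'] dist_m.
  exact/tame_decomposable_Speh/distinguished_sort.
exact/Speh_dual/tame_decomposable_Speh/distinguished_sort_dual.
Qed.

(** * Tame multisegments *)

(** A multiplicity is the sum of two alternating sums, so the premises of
    tameness at D force two copies of D. *)
Lemma set_tame (m : multisegment) : is_set m -> tame m.
Proof.
move=> set_m x D _ _ S_D S_nuD; have := altsum_rec m D; have := set_m D; lia.
Qed.

Lemma addn_le_endpoint_count (m : multisegment) (D E : segment) :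
  D != E -> edp D = edp E -> (m D + m E <= endpoint_count m (edp D))%N.
Proof.
move=> neDE eqDE; rewrite -!count_mem_mset -count_predUI.
rewrite [X in (_ + X)%N](eq_count (a2 := pred0)) ?count_pred0 ?addn0.
  apply: sub_count => F /= /orP[/eqP->|/eqP->]; rewrite ?eqDE; exact: eqxx.
by move=> F /=; case: eqP => //= ->; apply: negbTE.
Qed.

(** Two copies of D, forced as in [set_tame], leave no room for another segment
    with the same endpoint. *)
Lemma endpoint_count_le2_tame (m : multisegment) :
  (forall x : int, (endpoint_count m x <= 2)%N) -> tame m.
Proof.
move=> m_le2 x D m_x eqD S_D S_nuD G eqG S_G.
have [->//|neDG] := eqVneq D G; have := altsum_rec m D; have := altsum_rec m G.
have : 0 <= altsum m (nu G) by apply: m_x; rewrite edp_shift eqG; lia.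
have := addn_le_endpoint_count m neDG; rewrite eqD eqG => /(_ erefl).
by have := m_le2 x; lia.
Qed.

Theorem theorem1p7 :
  (forall m : multisegment, tame m \/ tame (dualm m) ->
     (distinguished m -> Speh_type m) /\
     (distinguished m /\ distinguished (dualm m) -> Speh_type m)) /\
  (forall m : multisegment, is_set m -> tame m) /\
  (forall m : multisegment,
     (forall x : int, (endpoint_count m x <= 2)%N) -> tame m) /\
  (exists m : multisegment, tame m /\ ~ is_set m) /\
  (exists m : multisegment,
     tame m /\ exists x : int, (2 < endpoint_count m x)%N).
Proof.
pose seg a : segment := @Segment (- a%:Z, 0) (oppr_le0 _).
split; first by move=> m /tame_distinguished_Speh SpehP; split=> [|[]] /SpehP.
split; first exact: set_tame.
split; first exact: endpoint_count_le2_tame.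
have countE (s : seq segment) x :
    endpoint_count (seq_mset s) x = count (fun D => edp D == x) s.
  exact/permP/perm_eq_seq_mset.
split.
  exists (seq_mset [:: seg0; seg0]); split.
    by apply: endpoint_count_le2_tame => x; rewrite countE; apply: count_size.
  by move/(_ seg0); rewrite mset_seqE.
exists (seq_mset [:: seg 0; seg 1; seg 2]); split; last first.
  by exists 0; rewrite countE.
by apply: set_tame => D; rewrite mset_seqE count_uniq_mem ?leq_b1.
Qed.
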